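(* Let $D\subsetneq\mathbb{R}^n$ be a domain, $x\in D$ and $t>0$. Then the following inclusion property holds true: $$B_{\tilde j_D}(x,r)\subseteq B_{\tilde\tau_D}(x,t)\subseteq B_{\tilde j_D}(x,R).$$ Here $r=t$ and $R=2t$. The radii $r$ and $R$ are the best possible.
   Context: Here $n\ge2$, $D$ is an arbitrary proper subdomain of the Euclidean space $\mathbb{R}^n$, $\partial D$ is its boundary and $d(x)=\mathrm{dist}(x,\partial D)$. For $x,y\in D$, $$\tilde\tau_D(x,y)=\log\left(1+\sup_{p\in\partial D}\frac{|x-y|}{\sqrt{|x-p||p-y|}}\right),\qquad \tilde j_D(x,y)=\log\left(1+\frac{|x-y|}{\min\{d(x),d(y)\}}\right).$$ For a metric $m$ on $D$, $B_m(x,\varrho)=\{z\in D: m(x,z)<\varrho\}$. *)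

(* Defs.v *)
From HB Require Import structures.
From mathcomp Require Import all_boot all_order all_algebra.
From mathcomp Require Import all_classical all_reals all_analysis.

Set Implicit Arguments.
Unset Strict Implicit.
Unset Printing Implicit Defensive.

Import Order.TTheory GRing.Theory Num.Theory.
Import numFieldNormedType.Exports.

Local Open Scope classical_set_scope.
Local Open Scope ring_scope.

(* The library norm on 'rV[R]_n is the sup norm. It induces the usual topology
   of R^n, so [open], [connected], [closure] and [interior] have their standard
   meaning, but the metrics below need the Euclidean distance. *)
Definition eucl_dist (R : realType) (n : nat) (x y : 'rV[R]_n) : R :=
  Num.sqrt (\sum_(i < n) (x ord0 i - y ord0 i) ^+ 2).

Definition boundary (T : topologicalType) (A : set T) : set T :=
  closure A `\` interior A.

Definition is_domain (T : topologicalType) (D : set T) : Prop :=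
  [/\ D !=set0, open D & connected D].

Definition bdist (R : realType) (n : nat) (D : set 'rV[R]_n)
    (x : 'rV[R]_n) : R :=
  inf [set eucl_dist x p | p in boundary D].

(* For D a proper subdomain of R^n and x, y in D, the set below is nonempty
   (its index set, the boundary, is nonempty) and bounded above by
   |x - y| / min (d x) (d y), so [sup] is a genuine least upper bound. *)
Definition tau_tilde (R : realType) (n : nat) (D : set 'rV[R]_n)
    (x y : 'rV[R]_n) : R :=
  ln (1 + sup [set eucl_dist x y / Num.sqrt (eucl_dist x p * eucl_dist p y)
              | p in boundary D]).

Definition j_tilde (R : realType) (n : nat) (D : set 'rV[R]_n)
    (x y : 'rV[R]_n) : R :=
  ln (1 + eucl_dist x y / Num.min (bdist D x) (bdist D y)).

Definition mball (R : realType) (T : Type) (D : set T) (m : T -> T -> R)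
    (x : T) (rho : R) : set T :=
  [set z | D z /\ m x z < rho].

(* Main.v *)
Require Import Defs.
From HB Require Import structures.
From mathcomp Require Import ring lra.
From mathcomp Require Import all_boot all_order all_algebra.
From mathcomp Require Import all_classical all_reals all_analysis.

Set Implicit Arguments.
Unset Strict Implicit.
Unset Printing Implicit Defensive.

Import Order.TTheory GRing.Theory Num.Theory.
Import numFieldNormedType.Exports.

Local Open Scope classical_set_scope.
Local Open Scope ring_scope.

(* Write L = |x - y|, S = sup_p L / sqrt(|x - p| |p - y|) and m for the minimum
   of d(x) and d(y). Since |x - p| >= d(x) and |p - y| >= d(y), S <= L / m. For
   the converse, L <= S sqrt(u (u + L)) with u = |x - p| forces
   L <= ((1 + S)^2 - 1) u; taking the infimum over p, and exchanging x and y,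
   1 + L / m <= (1 + S)^2. The factor 1 is sharp as y -> x and the factor 2 is
   sharp as y tends to a boundary point. *)

(** * Euclidean distance and sup-norm balls *)

Lemma cauchy_schwarz (R : realDomainType) (I : finType) (a b : I -> R) :
  (\sum_i a i * b i) ^+ 2 <= (\sum_i a i ^+ 2) * (\sum_i b i ^+ 2).
Proof.
set A := \sum_i a i ^+ 2; set B := \sum_i b i ^+ 2; set C := \sum_i a i * b i.
(* Lagrange's identity; summing over ordered pairs doubles both sides. *)
have lagrange : \sum_i \sum_j (a i * b j - a j * b i) ^+ 2
    = A * B + B * A - (C * C + C * C).
  rewrite /A /B /C !big_distrlr /= -!big_split -sumrB /=.
  apply: eq_bigr => i _; rewrite -!big_split -sumrB /=.
  by apply: eq_bigr => j _; ring.
have : 0 <= \sum_i \sum_j (a i * b j - a j * b i) ^+ 2.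
  by apply: sumr_ge0 => i _; apply: sumr_ge0 => j _; exact: sqr_ge0.
rewrite lagrange; lra.
Qed.

Lemma eucl_dist_ge0 (R : realType) (n : nat) (x y : 'rV[R]_n) :
  0 <= eucl_dist x y.
Proof. exact: sqrtr_ge0. Qed.

Lemma eucl_distC (R : realType) (n : nat) (x y : 'rV[R]_n) :
  eucl_dist x y = eucl_dist y x.
Proof.
by rewrite /eucl_dist; congr Num.sqrt; apply: eq_bigr => i _; ring.
Qed.

Lemma eucl_dist_triangle (R : realType) (n : nat) (y x z : 'rV[R]_n) :
  eucl_dist x z <= eucl_dist x y + eucl_dist y z.
Proof.
rewrite /eucl_dist.
set A := \sum_i (x ord0 i - y ord0 i) ^+ 2.
set B := \sum_i (y ord0 i - z ord0 i) ^+ 2.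
have A0 : 0 <= A by apply: sumr_ge0 => i _; exact: sqr_ge0.
have B0 : 0 <= B by apply: sumr_ge0 => i _; exact: sqr_ge0.
set C := \sum_i (x ord0 i - y ord0 i) * (y ord0 i - z ord0 i).
have -> : \sum_i (x ord0 i - z ord0 i) ^+ 2 = A + B + (C + C).
  rewrite /A /B /C -!big_split /=; apply: eq_bigr => i _; ring.
have CAB : C <= Num.sqrt A * Num.sqrt B.
  rewrite -sqrtrM //; apply: le_trans (ler_norm _) _.
  by rewrite -sqrtr_sqr ler_wsqrtr // cauchy_schwarz.
rewrite -[leRHS]ger0_norm ?addr_ge0 ?sqrtr_ge0 // -sqrtr_sqr ler_wsqrtr //.
rewrite sqrrD !sqr_sqrtr //; lra.
Qed.

Lemma coord_le_eucl_dist (R : realType) (n : nat) (x y : 'rV[R]_n) (i : 'I_n) :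
  `|x ord0 i - y ord0 i| <= eucl_dist x y.
Proof.
rewrite -sqrtr_sqr ler_wsqrtr // (bigD1 i) //= lerDl.
by apply: sumr_ge0 => j _; exact: sqr_ge0.
Qed.

Lemma eucl_dist_lt_ball (R : realType) (n : nat) (x y : 'rV[R]_n) (e : R) :
  eucl_dist x y < e -> ball x e y.
Proof.
move=> xye; split; first exact: le_lt_trans (eucl_dist_ge0 x y) xye.
move=> i j; rewrite (ord1 i).
exact: le_lt_trans (coord_le_eucl_dist x y j) xye.
Qed.

Lemma ball_eucl_dist_le (R : realType) (n : nat) (x y : 'rV[R]_n) (e : R) :
  ball x e y -> eucl_dist x y <= n%:R * e.
Proof.
move=> [e0 xye].
have le_sum : \sum_(i < n) (x ord0 i - y ord0 i) ^+ 2 <= n%:R * e ^+ 2.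
  have -> : n%:R * e ^+ 2 = \sum_(i < n) e ^+ 2.
    by rewrite sumr_const card_ord mulr_natl.
  apply: ler_sum => i _; rewrite -real_normK ?num_real //.
  by rewrite ler_pXn2r ?nnegrE ?(ltW e0) ?normr_ge0 //; exact: ltW (xye ord0 i).
(* The sum of squares gives the factor [sqrt n]; this weakens it to [n]. *)
have n_sqr : n%:R <= n%:R ^+ 2 :> R.
  by rewrite -natrX ler_nat; case: (n) => // m; rewrite leq_pmulr.
rewrite -[leRHS]ger0_norm ?mulr_ge0 ?ler0n ?(ltW e0) //.
rewrite -sqrtr_sqr ler_wsqrtr // (le_trans le_sum) // exprMn.
by rewrite ler_wpM2r ?sqr_ge0.
Qed.

(** * The boundary and the distance to it *)

Lemma boundary_neq0 (R : realType) (n : nat) (D : set 'rV[R]_n) :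
  D !=set0 -> D <> setT -> boundary D !=set0.
Proof.
move=> [x Dx] DT; apply: contrapT => /nonemptyPn bd0.
have cl_int : closure D `<=` interior D.
  by move=> p clp; apply: contrapT => nip; have : boundary D p by []; rewrite bd0.
have clopenD : clopen D.
  split; first by rewrite openE => p Dp; apply: cl_int; exact: subset_closure.
  by move=> p /cl_int; exact: interior_subset.
apply: DT; apply/seteqP; split=> // q _.
(* The line through [x] and [q]: the preimage of [D] is clopen in the connected real line and
   contains 0, hence also 1. *)
pose f (t : R^o) : 'rV[R]_n := x + t *: (q - x).
have f_cont : continuous f.
  move=> t; apply: cvgD; first exact: cvg_cst.
  exact: cvgZr_tmp.
have [opf clf] := preimage_clopen clopenD f_cont.
have /connected_intervalP connR : is_interval [set: R] by [].
have pre_setT : f @^-1` D = setT.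
  apply: connR; [|by exists (f @^-1` D); rewrite ?setTI..].
  by exists 0; rewrite /= /f scale0r addr0.
have : (f @^-1` D) 1 by rewrite pre_setT.
by rewrite /= /f scale1r addrC subrK.
Qed.

Lemma bdist_le (R : realType) (n : nat) (D : set 'rV[R]_n) (x p : 'rV[R]_n) :
  boundary D p -> bdist D x <= eucl_dist x p.
Proof.
move=> bp; apply: ge_inf; last by exists p.
by exists 0 => _ [q _ <-]; exact: eucl_dist_ge0.
Qed.

Lemma le_bdist (R : realType) (n : nat) (D : set 'rV[R]_n) (x : 'rV[R]_n)
    (a : R) : boundary D !=set0 ->
  (forall p, boundary D p -> a <= eucl_dist x p) -> a <= bdist D x.
Proof.
move=> [p bp] ale; apply: lb_le_inf; first by exists (eucl_dist x p), p.
by move=> _ [q bq <-]; exact: ale.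
Qed.

(** Passes to the infimum over the boundary in an estimate linear in the distance. The proof divides
    by [K], so [K = 0] is split off; there any boundary point gives [a <= 0]. *)
Lemma le_scaled_bdist (R : realType) (n : nat) (D : set 'rV[R]_n)
    (x : 'rV[R]_n) (a K : R) : boundary D !=set0 -> 0 <= K ->
  (forall p, boundary D p -> a <= K * eucl_dist x p) -> a <= K * bdist D x.
Proof.
move=> bD; rewrite le_eqVlt => /predU1P[<-|K0] ale.
  by have [p /ale] := bD; rewrite !mul0r.
rewrite mulrC -ler_pdivrMr //; apply: le_bdist => // p /ale.
by rewrite ler_pdivrMr // mulrC.
Qed.

Lemma bdist_gt0 (R : realType) (n : nat) (D : set 'rV[R]_n) (x : 'rV[R]_n) :
  boundary D !=set0 -> open D -> D x -> 0 < bdist D x.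
Proof.
move=> bD oD Dx; have /nbhs_ballP[e /= e0 xeD] := open_nbhs_nbhs (conj oD Dx).
apply: lt_le_trans e0 _; apply: le_bdist => // p [_ nip].
rewrite leNgt; apply/negP => /eucl_dist_lt_ball /xeD Dp.
by apply: nip; move: oD; rewrite openE; exact.
Qed.

Lemma bdist_lipschitz (R : realType) (n : nat) (D : set 'rV[R]_n)
    (x y : 'rV[R]_n) : boundary D !=set0 ->
  bdist D x <= eucl_dist x y + bdist D y.
Proof.
move=> bD; rewrite -lerBlDl; apply: le_bdist => // p bp.
by rewrite lerBlDl (le_trans (bdist_le x bp)) // eucl_dist_triangle.
Qed.

(** * The supremum inside the logarithm of [tau_tilde] *)

Definition tau_ratio (R : realType) (n : nat) (D : set 'rV[R]_n)
    (x y : 'rV[R]_n) : R :=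
  sup [set eucl_dist x y / Num.sqrt (eucl_dist x p * eucl_dist p y)
      | p in boundary D].

(** Serves twice: it bounds the supremum from above, and it shows that each term lies below the
    supremum, since [sup] is meaningful only for bounded sets. *)
Lemma tau_ratio_ubound (R : realType) (n : nat) (D : set 'rV[R]_n)
    (x y : 'rV[R]_n) :
  boundary D !=set0 -> open D -> D x -> D y ->
  ubound [set eucl_dist x y / Num.sqrt (eucl_dist x p * eucl_dist p y)
         | p in boundary D]
    (eucl_dist x y / Num.sqrt (bdist D x * bdist D y)).
Proof.
move=> bD oD Dx Dy _ [p bp <-].
have dx := bdist_gt0 bD oD Dx; have dy := bdist_gt0 bD oD Dy.
have xp := bdist_le x bp; have yp := bdist_le y bp.
rewrite (eucl_distC p y) ler_wpM2l ?eucl_dist_ge0 //.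
rewrite lef_pV2 ?posrE ?sqrtr_gt0 ?mulr_gt0 //;
  [|exact: lt_le_trans xp|exact: lt_le_trans yp].
by rewrite ler_wsqrtr // ler_pM // ltW.
Qed.

Lemma tau_ratio_le (R : realType) (n : nat) (D : set 'rV[R]_n)
    (x y : 'rV[R]_n) :
  boundary D !=set0 -> open D -> D x -> D y ->
  tau_ratio D x y <= eucl_dist x y / Num.sqrt (bdist D x * bdist D y).
Proof.
move=> bD oD Dx Dy; apply: ge_sup; last exact: tau_ratio_ubound.
by have [p bp] := bD; eexists; exists p.
Qed.

Lemma le_tau_ratio (R : realType) (n : nat) (D : set 'rV[R]_n)
    (x y p : 'rV[R]_n) :
  open D -> D x -> D y -> boundary D p ->
  eucl_dist x y <= tau_ratio D x y * Num.sqrt (eucl_dist x p * eucl_dist p y).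
Proof.
move=> oD Dx Dy bp; have bD : boundary D !=set0 by exists p.
rewrite -ler_pdivrMr; last first.
  rewrite sqrtr_gt0 (eucl_distC p y).
  by rewrite mulr_gt0 // (lt_le_trans (bdist_gt0 bD oD _) (bdist_le _ bp)).
apply: ub_le_sup; last by exists p.
by eexists; exact: tau_ratio_ubound.
Qed.

Lemma tau_ratio_ge0 (R : realType) (n : nat) (D : set 'rV[R]_n)
    (x y : 'rV[R]_n) : 0 <= tau_ratio D x y.
Proof.
rewrite /tau_ratio; set E := [set _ | _ in _].
(* Without a genuine least upper bound, [sup] has the default value 0. *)
have [hasE|/sup_out -> //] := pselect (has_sup E).
have [[_ [p bp _]] ubE] := hasE.
apply: le_trans (ub_le_sup ubE _); last by exists p.
by rewrite divr_ge0 ?eucl_dist_ge0 ?sqrtr_ge0.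
Qed.

Lemma tau_ratioC (R : realType) (n : nat) (D : set 'rV[R]_n)
    (x y : 'rV[R]_n) : tau_ratio D x y = tau_ratio D y x.
Proof.
congr sup; apply: eq_imagel => p _.
rewrite (eucl_distC x y) (eucl_distC x p) (eucl_distC p y).
by rewrite (mulrC (eucl_dist p x)).
Qed.

(** Both [|x - p|] and [|p - y|] are at most [|x - y| + |x - p|], hence so is their geometric mean.
    For [y] near [x] this gives the sharp first-order lower bound on [tau_ratio], where
    [eucl_dist_le_bdist] loses a factor 2. *)
Lemma eucl_dist_le_tau_ratio (R : realType) (n : nat) (D : set 'rV[R]_n)
    (x y : 'rV[R]_n) :
  boundary D !=set0 -> open D -> D x -> D y ->
  eucl_dist x y <= tau_ratio D x y * (eucl_dist x y + bdist D x).
Proof.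
move=> bD oD Dx Dy; rewrite mulrDr -lerBlDl.
apply: le_scaled_bdist => [//||p bp]; first exact: tau_ratio_ge0.
rewrite lerBlDl -mulrDr; apply: le_trans (le_tau_ratio oD Dx Dy bp) _.
rewrite ler_wpM2l ?tau_ratio_ge0 //.
have pxy := eucl_dist_triangle x p y; rewrite (eucl_distC p x) in pxy.
have xy0 := eucl_dist_ge0 x y; have xp0 := eucl_dist_ge0 x p.
rewrite -[leRHS]ger0_norm ?addr_ge0 // -sqrtr_sqr ler_wsqrtr //.
by rewrite expr2 ler_pM ?eucl_dist_ge0 ?lerDr // addrC.
Qed.

Lemma eucl_dist_le_bdist (R : realType) (n : nat) (D : set 'rV[R]_n)
    (x y : 'rV[R]_n) :
  boundary D !=set0 -> open D -> D x -> D y ->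
  eucl_dist x y <= ((1 + tau_ratio D x y) ^+ 2 - 1) * bdist D x.
Proof.
move=> bD oD Dx Dy; have S0 := tau_ratio_ge0 D x y.
apply: le_scaled_bdist => [//||p bp].
  by rewrite subr_ge0 exprn_ege1 // lerDl.
have := le_tau_ratio oD Dx Dy bp.
have pxy := eucl_dist_triangle x p y; rewrite (eucl_distC p x) in pxy.
have xy0 := eucl_dist_ge0 x y; have xp0 := eucl_dist_ge0 x p.
have py0 := eucl_dist_ge0 p y.
move: (tau_ratio D x y) (eucl_dist x y) (eucl_dist x p) (eucl_dist p y)
  S0 pxy xy0 xp0 py0 => S L u v S0 vle L0 u0 v0 Lle.
have Lsqr : L ^+ 2 <= S ^+ 2 * (u * (u + L)).
  rewrite (le_trans (_ : _ <= (S * Num.sqrt (u * v)) ^+ 2)) //.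
    by rewrite ler_pXn2r // nnegrE mulr_ge0 ?sqrtr_ge0.
  by rewrite exprMn sqr_sqrtr ?mulr_ge0 // ler_wpM2l ?sqr_ge0 // ler_wpM2l.
have Su0 : 0 <= S * u by rewrite mulr_ge0.
(* If [L > (2 S + S^2) u], then [L - S^2 u > 2 S u] and [L > S u], so [L^2 - S^2 u L > 2 (S u)^2],
   while [Lsqr] bounds the left side by [(S u)^2]. *)
rewrite leNgt; apply/negP => ltL.
have : (L - S ^+ 2 * u) * L > (2 * (S * u)) * (S * u).
  apply: ltr_pM => //; [lra|nra|nra].
nra.
Qed.

(** * Comparison of [tau_tilde] and [j_tilde] *)

Lemma eucl_dist_div_min_ge0 (R : realType) (n : nat) (D : set 'rV[R]_n)
    (x y : 'rV[R]_n) : boundary D !=set0 ->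
  0 <= eucl_dist x y / Num.min (bdist D x) (bdist D y).
Proof.
move=> bD; have bdist_ge0 z : 0 <= bdist D z.
  by apply: le_bdist => // p _; exact: eucl_dist_ge0.
by rewrite divr_ge0 ?eucl_dist_ge0 // le_min !bdist_ge0.
Qed.

Lemma j_tilde_ge0 (R : realType) (n : nat) (D : set 'rV[R]_n)
    (x y : 'rV[R]_n) : boundary D !=set0 -> 0 <= j_tilde D x y.
Proof. by move=> bD; rewrite ln_ge0 // lerDl eucl_dist_div_min_ge0. Qed.

Lemma tau_tilde_le_j_tilde (R : realType) (n : nat) (D : set 'rV[R]_n)
    (x y : 'rV[R]_n) :
  boundary D !=set0 -> open D -> D x -> D y ->
  tau_tilde D x y <= j_tilde D x y.
Proof.
move=> bD oD Dx Dy.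
have dx := bdist_gt0 bD oD Dx; have dy := bdist_gt0 bD oD Dy.
have m0 : 0 < Num.min (bdist D x) (bdist D y) by rewrite lt_min dx.
rewrite /tau_tilde /j_tilde -/(tau_ratio D x y).
rewrite ler_ln ?posrE ?ltr_pwDl ?tau_ratio_ge0 ?eucl_dist_div_min_ge0 //.
rewrite lerD2l (le_trans (tau_ratio_le bD oD Dx Dy)) //.
rewrite ler_wpM2l ?eucl_dist_ge0 //.
rewrite lef_pV2 ?posrE ?sqrtr_gt0 ?mulr_gt0 //.
(* A geometric mean is at least the minimum. *)
rewrite -[leLHS]ger0_norm ?(ltW m0) // -sqrtr_sqr ler_wsqrtr // expr2.
by rewrite ler_pM ?(ltW m0) // ge_min lexx ?orbT.
Qed.

Lemma j_tilde_le_tau_tilde (R : realType) (n : nat) (D : set 'rV[R]_n)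
    (x y : 'rV[R]_n) :
  boundary D !=set0 -> open D -> D x -> D y ->
  j_tilde D x y <= 2 * tau_tilde D x y.
Proof.
move=> bD oD Dx Dy.
have dx := bdist_gt0 bD oD Dx; have dy := bdist_gt0 bD oD Dy.
have m0 : 0 < Num.min (bdist D x) (bdist D y) by rewrite lt_min dx.
have S0 := tau_ratio_ge0 D x y.
rewrite /tau_tilde /j_tilde -/(tau_ratio D x y) mulr_natl -lnXn ?ltr_pwDl //.
rewrite ler_ln ?posrE ?exprn_gt0 ?ltr_pwDl ?eucl_dist_div_min_ge0 //.
rewrite -lerBrDl ler_pdivrMr //.
(* By symmetry, the point nearer to the boundary can be put first. *)
have [_|_] := leP (bdist D x) (bdist D y); first exact: eucl_dist_le_bdist.
by rewrite eucl_distC tau_ratioC; exact: eucl_dist_le_bdist.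
Qed.

Lemma tau_tilde_ge0 (R : realType) (n : nat) (D : set 'rV[R]_n)
    (x y : 'rV[R]_n) : 0 <= tau_tilde D x y.
Proof. by rewrite ln_ge0 // lerDl tau_ratio_ge0. Qed.

(** * Sharpness of the factors 1 and 2 *)

Lemma ln1D_ge (R : realType) (u : R) : 0 <= u -> u / (1 + u) <= ln (1 + u).
Proof.
move=> u0; have u1 : 0 < 1 + u by rewrite ltr_pwDl.
rewrite -[ln _]opprK -lnV ?posrE // lerNr.
(* Prepares [ln (1 + v) <= v] at [v = - u / (1 + u)]. *)
have invE : (1 + u)^-1 = 1 + - (u / (1 + u)) by field; lra.
rewrite [X in ln X]invE.
by apply: le_ln1Dx; rewrite ltrN2 ltr_pdivrMr //; lra.
Qed.

Lemma eucl_dist_add_delta (R : realType) (n : nat) (x : 'rV[R]_n) (i : 'I_n)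
    (a : R) : 0 <= a -> eucl_dist x (x + a *: delta_mx ord0 i) = a.
Proof.
move=> a0; rewrite /eucl_dist (bigD1 i) //= big1 => [|j ji].
  rewrite !mxE !eqxx mulr1 opprD addrA subrr add0r sqrrN addr0.
  by rewrite sqrtr_sqr ger0_norm.
by rewrite !mxE (negPf ji) andbF mulr0 addr0 subrr expr0n.
Qed.

Lemma exists_near_boundary (R : realType) (n : nat) (D : set 'rV[R]_n)
    (p : 'rV[R]_n) (e : R) : (0 < n)%N -> boundary D p -> 0 < e ->
  exists2 y, D y & eucl_dist p y <= e.
Proof.
(* Radius [e / n] compensates the factor [n] of [ball_eucl_dist_le]. *)
move=> n0 [clp _] e0; have en0 : 0 < e / n%:R by rewrite divr_gt0 ?ltr0n.
have [y [Dy pye]] := clp _ (nbhsx_ballx p _ en0).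
exists y => //; apply: le_trans (ball_eucl_dist_le pye) _.
by rewrite mulrC divfK // pnatr_eq0 -lt0n.
Qed.

(* Near [x] both [tau_tilde] and [j_tilde] are asymptotic to
   [eucl_dist x y / bdist D x]. *)
Lemma best_inner_radius (R : realType) (n : nat) (D : set 'rV[R]_n)
    (x : 'rV[R]_n) (c : R) :
  (0 < n)%N -> boundary D !=set0 -> open D -> D x ->
  (forall y, D y -> c * tau_tilde D x y <= j_tilde D x y) -> c <= 1.
Proof.
move=> n0 bD oD Dx cle; rewrite leNgt; apply/negP => c1.
have d0 := bdist_gt0 bD oD Dx.
have /nbhs_ballP[e /= e0 xeD] := open_nbhs_nbhs (conj oD Dx).
set d := bdist D x in d0.
(* [s] will be [|x - y| / d]. The first bound yields [s (c + 2) < c - 1], which is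
   [s / (1 - s) < c s / (1 + 2 s)]; the second keeps [y] inside [D]. *)
pose s := Num.min ((c - 1) / (2 * (c + 2))) (e / (2 * d)).
have s0 : 0 < s by rewrite lt_min !divr_gt0 //; lra.
have s_c : s * (2 * (c + 2)) <= c - 1.
  by rewrite -ler_pdivlMr ?ge_min ?lexx //; lra.
have s_half : s < 2^-1 by nra.
have sd_e : s * d < e.
  have : s * (2 * d) <= e by rewrite -ler_pdivlMr ?ge_min ?lexx ?orbT //; lra.
  have : 0 < s * d by rewrite mulr_gt0.
  lra.
pose y := x + (s * d) *: delta_mx ord0 (Ordinal n0).
have xyE : eucl_dist x y = s * d by rewrite eucl_dist_add_delta // mulr_ge0 // ltW.
have Dy : D y by apply: xeD; apply: eucl_dist_lt_ball; rewrite xyE.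
(* From [s <= S (1 + s)] follows [S / (1 + S) >= s / (1 + 2 s)]. *)
have tau_ge : s / (1 + 2 * s) <= tau_tilde D x y.
  have S0 := tau_ratio_ge0 D x y.
  apply: le_trans (ln1D_ge S0).
  have := eucl_dist_le_tau_ratio bD oD Dx Dy; rewrite xyE -/d.
  rewrite -[X in _ * (_ + X)]mul1r -mulrDl mulrA ler_pM2r // => sS.
  rewrite ler_pdivrMr; last lra.
  rewrite mulrAC ler_pdivlMr; [nra|lra].
(* The Lipschitz bound gives [bdist D y >= d (1 - s)]; then [ln (1 + v) <= v]. *)
have j_le : j_tilde D x y <= s / (1 - s).
  have m_ge : d * (1 - s) <= Num.min d (bdist D y).
    rewrite le_min; apply/andP; split; first nra.
    by have := bdist_lipschitz x y bD; rewrite xyE -/d; lra.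
  have m0 : 0 < d * (1 - s) by rewrite mulr_gt0 //; lra.
  apply: le_trans (le_ln1Dx _) _.
    by rewrite (lt_le_trans _ (eucl_dist_div_min_ge0 x y bD)) // ltrN10.
  rewrite xyE -/d ler_pdivrMr ?(lt_le_trans m0) //.
  rewrite mulrAC ler_pdivlMr; last lra.
  nra.
have := cle _ Dy; apply/negP; rewrite -ltNge.
apply: (le_lt_trans j_le).
apply: (@lt_le_trans _ _ (c * (s / (1 + 2 * s)))); last by rewrite ler_pM2l //; lra.
rewrite ltr_pdivrMr; last lra.
rewrite mulrA mulrAC ltr_pdivlMr; last lra.
nra.
Qed.

(* As [y] tends to a boundary point, [j_tilde D x y] grows like
   [- ln (bdist D y)] and [tau_tilde D x y] at most like half of it. *)
Lemma best_outer_radius (R : realType) (n : nat) (D : set 'rV[R]_n)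
    (x : 'rV[R]_n) (C : R) :
  (0 < n)%N -> boundary D !=set0 -> open D -> D x -> 0 <= C ->
  (forall y, D y -> j_tilde D x y <= C * tau_tilde D x y) -> 2 <= C.
Proof.
move=> n0 bD oD Dx C0 leC; rewrite leNgt; apply/negP => C2.
have d0 := bdist_gt0 bD oD Dx.
have [p bp] := bD; have xp := bdist_le x bp.
set d := bdist D x in d0 xp.
(* With [h = bdist D y], [M] bounds [|x - y|] and [K / h] bounds [(1 + S)^2]. The resulting
   logarithmic bounds and [leC] give [(2 - C) (- ln h) <= Q]; the exponential in [e] makes [- ln h]
   at least [Q / (2 - C) + 1], a contradiction. *)
pose M := eucl_dist x p + d / 2.
have M0 : 0 < M by rewrite /M; lra.
pose K := 2 + 2 * M ^+ 2 / d.
pose Q := C * ln K - 2 * ln (d / 2).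
pose e := Num.min (Num.min 1 (d / 2)) (expR (- (Q / (2 - C) + 1))).
have e0 : 0 < e by rewrite !lt_min ltr01 expR_gt0 divr_gt0.
have e1 : e <= 1 by rewrite !ge_min lexx.
have ed : e <= d / 2 by rewrite !ge_min lexx orbT.
have eQ : e <= expR (- (Q / (2 - C) + 1)) by rewrite !ge_min lexx !orbT.
have [y Dy pye] := exists_near_boundary n0 bp e0.
have h0 := bdist_gt0 bD oD Dy.
have he : bdist D y <= e by apply: le_trans (bdist_le y bp) _; rewrite eucl_distC.
set h := bdist D y in h0 he.
have xyM : eucl_dist x y <= M.
  by apply: le_trans (eucl_dist_triangle p x y) _; rewrite /M; lra.
have xyd : d / 2 <= eucl_dist x y.
  by have := eucl_dist_triangle y x p; rewrite (eucl_distC y p); lra.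
have j_ge : ln (d / 2) - ln h <= j_tilde D x y.
  have m0 : 0 < Num.min d h by rewrite lt_min d0.
  rewrite -ln_div ?posrE ?divr_gt0 // /j_tilde -/d -/h.
  rewrite ler_ln ?posrE ?divr_gt0 ?ltr_pwDl ?eucl_dist_div_min_ge0 //.
  apply: ler_wpDl => //; apply: ler_pM => //; first lra.
    by rewrite invr_ge0 ltW.
  by rewrite lef_pV2 ?posrE // ge_min lexx orbT.
have tau_le : 2 * tau_tilde D x y <= ln K - ln h.
  have S0 := tau_ratio_ge0 D x y.
  have K0 : 0 < K by rewrite ltr_pwDl // divr_ge0 ?mulr_ge0 ?sqr_ge0 // ltW.
  rewrite /tau_tilde -/(tau_ratio D x y) mulr_natl -lnXn ?ltr_pwDl //.
  rewrite -ln_div ?posrE // ler_ln ?posrE ?exprn_gt0 ?ltr_pwDl ?divr_gt0 //.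
  have S_le : tau_ratio D x y ^+ 2 <= M ^+ 2 / (d * h).
    rewrite -[d * h]sqr_sqrtr ?mulr_ge0 ?(ltW d0) ?(ltW h0) // -expr_div_n.
    rewrite ler_pXn2r ?nnegrE ?divr_ge0 ?sqrtr_ge0 ?(ltW M0) //.
    apply: le_trans (tau_ratio_le bD oD Dx Dy) _.
    by rewrite ler_wpM2r // invr_ge0 sqrtr_ge0.
  have h_inv : 2 <= 2 / h by rewrite ler_pdivlMr //; lra.
  have -> : K / h = 2 / h + 2 * (M ^+ 2 / (d * h)).
    by rewrite /K; field; rewrite !gt_eqF.
  (* That is, [(1 + S)^2 <= 2 + 2 S^2]; [h <= 1] lets [2 / h] absorb the constant 2. *)
  have : 0 <= (1 - tau_ratio D x y) ^+ 2 by exact: sqr_ge0.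
  nra.
have lnh : Q / (2 - C) + 1 <= - ln h.
  by rewrite lerNr -ler_expR lnK ?posrE // (le_trans he).
have := leC _ Dy; have : 0 < 2 - C by lra.
move: lnh; set q := Q / (2 - C) => lnh C2'.
have QE : C * ln K - 2 * ln (d / 2) = q * (2 - C).
  by rewrite /q divfK // gt_eqF.
nra.
Qed.

(* The radii r = t and R = 2 t are best possible in the sense that, already for
   the given D and x, the factor 1 cannot be replaced by a larger constant and
   the factor 2 cannot be replaced by a smaller one. *)
Theorem theorem4p7 (R : realType) (n : nat) (n_ge2 : (2 <= n)%N)
    (D : set 'rV[R]_n) (domD : is_domain D) (properD : D <> setT)
    (x : 'rV[R]_n) (Dx : D x) :
  [/\ forall t : R, 0 < t ->
        mball D (j_tilde D) x t `<=` mball D (tau_tilde D) x t /\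
        mball D (tau_tilde D) x t `<=` mball D (j_tilde D) x (2 * t),
      forall c : R,
        (forall t : R, 0 < t ->
           mball D (j_tilde D) x (c * t) `<=` mball D (tau_tilde D) x t) ->
        c <= 1
    & forall C : R,
        (forall t : R, 0 < t ->
           mball D (tau_tilde D) x t `<=` mball D (j_tilde D) x (C * t)) ->
        2 <= C].
Proof.
have [D0 oD _] := domD.
have n0 : (0 < n)%N by exact: ltnW.
have bD := boundary_neq0 D0 properD.
split.
- move=> t _; split=> y [Dy yt]; split=> //.
    exact: le_lt_trans (tau_tilde_le_j_tilde bD oD Dx Dy) yt.
  by apply: le_lt_trans (j_tilde_le_tau_tilde bD oD Dx Dy) _; rewrite ltr_pM2l.
- move=> c incl; apply: (best_inner_radius n0 bD oD Dx) => y Dy.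
  (* The inclusion is tested at radius [tau_tilde D x y], whose open ball omits [y]; radius 0 is
     treated apart. *)
  have := tau_tilde_ge0 D x y; rewrite le_eqVlt => /predU1P[<-|tau0].
    by rewrite mulr0 j_tilde_ge0.
  rewrite leNgt; apply/negP => jlt.
  by have [_] := incl _ tau0 y (conj Dy jlt); rewrite ltxx.
- move=> C incl.
  (* A [tau_tilde] ball of radius [tau_tilde D x x + 1] contains its centre, so the corresponding
     [j_tilde] ball is nonempty and its radius is positive. *)
  have C0 : 0 < C.
    have t0 : 0 < tau_tilde D x x + 1 by rewrite ltr_wpDl // tau_tilde_ge0.
    have [_] : mball D (j_tilde D) x (C * (tau_tilde D x x + 1)) x.
      by apply: incl => //; split=> //; rewrite ltrDl.
    by move=> /(le_lt_trans (j_tilde_ge0 _ _ bD)); rewrite pmulr_lgt0.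
  apply: (best_outer_radius n0 bD oD Dx (ltW C0)) => y Dy.
  (* The radius tested is [j_tilde D x y / C], so that [C] times it is exactly [j_tilde D x y]. *)
  rewrite leNgt; apply/negP; rewrite mulrC -ltr_pdivlMr // => tau_lt.
  have t0 := le_lt_trans (tau_tilde_ge0 D x y) tau_lt.
  by have [_] := incl _ t0 y (conj Dy tau_lt); rewrite mulrC divfK ?gt_eqF // ltxx.
Qed.
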